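(* Let $\varkappa$ be a kernel satisfying conditions (K1) with $\kappa=5$, i.e. $m_5(\varkappa)<\infty$, and (K2), i.e. $\inf_{x\in[1,e]}\varkappa(x)=:\zeta$. Then for $h\in\mathscr{V}^{\mathrm{w}}_+(\mathbb{R}_+)$ (with $m>0$ the parameter of the operator), $$\|\mathscr{M}^{\varkappa}_m(h,\cdot)-h\|_{\mathrm{w}}\le\frac{256\,\Upsilon\!\left(h,\frac1m\right)}{\zeta}\left[m_0(\varkappa)+4\,m_5(\varkappa)\right].$$
   Context: $\mathbb{R}_+$ is the set of positive reals; $\bigvee_{j\in\Lambda}T_j:=\sup\{T_j: j\in\Lambda\}$. The weight is $\mathrm{w}(z)=\frac{1}{1+\log^2 z}$ and $\|h\|_{\mathrm{w}}=\sup_{z>0}\mathrm{w}(z)|h(z)|$. A function $f:\mathbb{R}_+\to\mathbb{R}$ is log-uniformly continuous if for every $\epsilon>0$ there is $\rho>0$ such that $|f(z_1)-f(z_2)|<\epsilon$ whenever $|\log z_1-\log z_2|\le\rho$, $z_1,z_2>0$. $\mathscr{V}(\mathbb{R}_+)$ is the space of bounded log-uniformly continuous functions on $\mathbb{R}_+$; $\mathscr{V}^{\mathrm{w}}(\mathbb{R}_+)=\{h:\mathbb{R}_+\to\mathbb{R}:\ \mathrm{w}h\in\mathscr{V}(\mathbb{R}_+)\}$, and $\mathscr{V}^{\mathrm{w}}_+(\mathbb{R}_+)$ is the subclass of its nonnegative functions. The weighted logarithmic modulus of continuity of $h\in\mathscr{V}^{\mathrm{w}}(\mathbb{R}_+)$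 at $\rho>0$ is $$\Upsilon(h,\rho)=\sup_{|\log u|\le\rho,\ z>0}\frac{|h(uz)-h(z)|}{(1+\log^2z)(1+\log^2u)}.$$ A kernel is a bounded measurable function $\varkappa:\mathbb{R}_+\to\mathbb{R}$ satisfying: (K1) for the given order $\kappa>0$ the discrete absolute moment $m_\kappa(\varkappa)$ is finite, where for $\mu\ge0$, $m_\mu(\varkappa)=\sup_{s>0}\bigvee_{j\in\mathbb{Z}}|\varkappa(e^{-j}s)|\,|j-\log s|^{\mu}$ (with $0^0=1$); (K2) $\inf_{x\in[1,e]}\varkappa(x)=:\zeta$. For locally integrable $h:\mathbb{R}_+\to\mathbb{R}$, $m>0$ and $z>0$, the max-product Kantorovich exponential sampling operator is $$\mathscr{M}^{\varkappa}_m(h,z)=\frac{\bigvee_{j\in\mathbb{Z}}\varkappa(e^{-j}z^m)\,m\int_{j/m}^{(j+1)/m}h(e^v)\,dv}{\bigvee_{j\in\mathbb{Z}}\varkappa(e^{-j}z^m)},$$ where the denominator is assumed to be nonzero.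
   Formalization: The formal theorem assumes m ≥ 1 instead of m > 0, and ζ > 0. For small m the bound fails: with ϰ the indicator of [1,e], h = log² z, z = 1, m = 1/100, the left side exceeds 3333 while the right side is at most 1920. For ζ ≤ 0 the bound is undefined or has a nonpositive right side. *)

(* Defs.v *)
From HB Require Import structures.
From mathcomp Require Import all_boot all_order all_algebra.
From mathcomp Require Import all_classical all_reals all_analysis.

Set Implicit Arguments.
Unset Strict Implicit.
Unset Printing Implicit Defensive.

Import Order.TTheory GRing.Theory Num.Theory.
Import numFieldNormedType.Exports.

Local Open Scope classical_set_scope.
Local Open Scope ring_scope.

(* Functions on the positive reals are total functions R -> R, of which only
   the values at positive arguments are ever used. *)

Definition weight (R : realType) (z : R) : R := 1 / (1 + ln z ^+ 2).

(* Suprema which may be infinite (norm, modulus, moments) are taken in \bar R,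
   since the real-valued sup of an unbounded set is 0. *)
Definition wnorm (R : realType) (h : R -> R) : \bar R :=
  ereal_sup [set (weight z * `|h z|)%:E | z in [set z : R | 0 < z]].

Definition log_unif_continuous (R : realType) (f : R -> R) : Prop :=
  forall eps : R, 0 < eps -> exists2 rho : R, 0 < rho &
    forall z1 z2 : R, 0 < z1 -> 0 < z2 ->
      `|ln z1 - ln z2| <= rho -> `|f z1 - f z2| < eps.

Definition bounded_Rpos (R : realType) (f : R -> R) : Prop :=
  exists M : R, forall z : R, 0 < z -> `|f z| <= M.

Definition logV (R : realType) : set (R -> R) :=
  [set f | bounded_Rpos f /\ log_unif_continuous f].

Definition logVw (R : realType) : set (R -> R) :=
  [set h | logV (fun z => weight z * h z)].

Definition logVw_nonneg (R : realType) : set (R -> R) :=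
  [set h | logVw h /\ forall z : R, 0 < z -> 0 <= h z].

Definition log_modulus (R : realType) (h : R -> R) (rho : R) : \bar R :=
  ereal_sup [set y : \bar R | exists u z : R,
    [/\ 0 < u, 0 < z, `|ln u| <= rho &
        y = (`|h (u * z) - h z|
               / ((1 + ln z ^+ 2) * (1 + ln u ^+ 2)))%:E]].

(* powR satisfies 0 `^ 0 = 1, as required for mu = 0. *)
Definition abs_moment (R : realType) (k : R -> R) (mu : R) : \bar R :=
  ereal_sup [set ereal_sup (range (fun j : int =>
      (`|k (expR (- j%:~R) * s)| * `|j%:~R - ln s| `^ mu)%:E))
    | s in [set s : R | 0 < s]].

Record is_kernel (R : realType) (order : R) (k : R -> R) : Prop := IsKernel {
  kernel_measurable : measurable_fun [set x : R | 0 < x] k;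
  kernel_bounded : bounded_Rpos k;
  kernel_moment : (abs_moment k order < +oo)%E }.

Definition kernel_inf (R : realType) (k : R -> R) : R :=
  inf [set k x | x in `[1, expR 1]].

(* Both suprema are over sets of reals that are bounded above whenever k is a
   kernel of order 5 and h belongs to logVw, so the real-valued sup applies. *)
Definition maxprod_kantorovich (R : realType) (k : R -> R) (m : R)
    (h : R -> R) (z : R) : R :=
  sup (range (fun j : int =>
    k (expR (- j%:~R) * z `^ m) *
    (m * \int[lebesgue_measure]_(v in `[j%:~R / m, (j%:~R + 1) / m])
           h (expR v))))
  / sup (range (fun j : int => k (expR (- j%:~R) * z `^ m))).

(* Main.v *)
Require Import Defs.
From HB Require Import structures.
From mathcomp Require Import all_boot all_order all_algebra.
From mathcomp Require Import all_classical all_reals all_analysis.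
From mathcomp Require Import lra ring.

Set Implicit Arguments.
Unset Strict Implicit.
Unset Printing Implicit Defensive.

Import Order.TTheory GRing.Theory Num.Theory.
Import numFieldNormedType.Exports.

Local Open Scope classical_set_scope.
Local Open Scope ring_scope.

(** Numerator and denominator of the operator are suprema over the same index
    set, so, as [h z >= 0], their quotient differs from [h z] by at most
    [sup_j |k_j| |A_j - h z|] divided by the denominator, where [A_j] is the
    mean of [v |-> h (e^v)] over [[j/m, (j+1)/m]].  The denominator is at least
    [kernel_inf k], because some [e^(-j) z^m] lies in [[1, e]].  Walking from
    [ln z] to [v] in at most [2 + y] steps of length at most [1/m], with
    [y = |j - m ln z|], bounds [|A_j - h z|] by a cubic polynomial in [y] times
    [(1 + ln^2 z) * log_modulus h (1/m)].  The cubic is at most a multiple of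
    [1 + y^5], which the moments of orders 0 and 5 absorb. *)

(** * Growth of a function with controlled increments *)

(** Moves the weight at an intermediate point of a walk back to its start. *)
Lemma onesqD_le (R : realDomainType) (a b : R) :
  1 + (a + b) ^+ 2 <= 2 * (1 + a ^+ 2) * (1 + b ^+ 2).
Proof.
rewrite -subr_ge0.
rewrite (_ : _ - _ = 1 + (a - b) ^+ 2 + 2 * (a * b) ^+ 2); last by ring.
rewrite addr_ge0//; first by rewrite addr_ge0 ?sqr_ge0.
by rewrite mulr_ge0 ?sqr_ge0.
Qed.

(* The increment t is split into n steps of length at most r. *)
Lemma chained_modulus (R : realFieldType) (g : R -> R) (U r : R) :
  0 <= U -> r <= 1 ->
  (forall a d, `|d| <= r ->
     `|g (a + d) - g a| <= U * ((1 + a ^+ 2) * (1 + d ^+ 2))) ->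
  forall a t (n : nat), (0 < n)%N -> `|t| <= n%:R * r ->
  `|g (a + t) - g a| <= n%:R * (4 * U * (1 + a ^+ 2) * (1 + t ^+ 2)).
Proof.
move=> U0 r1 gU a t n n0 tnr.
have n0R : 0 < n%:R :> R by rewrite ltr0n.
pose d := t / n%:R.
have dr : `|d| <= r by rewrite normrM normfV (gtr0_norm n0R) ler_pdivrMr// mulrC.
have d1 : d ^+ 2 <= 1.
  by rewrite -(real_normK (num_real d)) expr_le1 ?(le_trans dr).
(* The induction runs over the number [i] of steps taken, while [n] and hence the step [d] stay
   fixed. *)
suff step (i : nat) : (i <= n)%N ->
    `|g (a + i%:R * d) - g a| <= i%:R * (4 * U * (1 + a ^+ 2) * (1 + t ^+ 2)).
  by move: (step n (leqnn n)); rewrite /d mulrCA divff ?mulr1// gt_eqF.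
elim: i => [_|i IH lein]; first by rewrite !mul0r addr0 subrr normr0.
have -> : g (a + i.+1%:R * d) - g a =
  (g (a + i%:R * d + d) - g (a + i%:R * d)) + (g (a + i%:R * d) - g a).
  by rewrite -natr1 mulrDl mul1r addrA subrKA.
rewrite (le_trans (ler_normD _ _))// -natr1 mulrDl mul1r addrC.
rewrite lerD ?IH 1?ltnW// (le_trans (gU _ _ dr))//.
(* 4 = 2 * 2: one factor comes from [onesqD_le], the other from 1 + d^2 <= 2. *)
have -> : 4 * U * (1 + a ^+ 2) * (1 + t ^+ 2) =
  U * (2 * (1 + a ^+ 2) * (1 + t ^+ 2) * 2) by ring.
rewrite ler_wpM2l// ler_pM//; [by rewrite addr_ge0 ?sqr_ge0..| |lra].
rewrite (le_trans (onesqD_le _ _))// ler_wpM2l//.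
  by rewrite mulr_ge0// addr_ge0 ?sqr_ge0.
rewrite lerD2l -(real_normK (num_real (_ * d))) -[leRHS](real_normK (num_real t)).
rewrite lerXn2r ?nnegrE//.
rewrite /d mulrCA normrM ler_piMr// ger0_norm ?divr_ge0//.
by rewrite ler_pdivrMr// mul1r ler_nat ltnW.
Qed.

Lemma modulus_growth (R : archiRealFieldType) (g : R -> R) (U m : R) :
  0 <= U -> 1 <= m ->
  (forall a d, `|d| <= 1 / m ->
     `|g (a + d) - g a| <= U * ((1 + a ^+ 2) * (1 + d ^+ 2))) ->
  forall a t y, m * `|t| <= y + 1 -> 0 <= y ->
  `|g (a + t) - g a| <= 60 * U * (1 + a ^+ 2) * (1 + y ^+ 5).
Proof.
move=> U0 m1 gU a t y ty y0.
have m0 : 0 < m by rewrite (lt_le_trans _ m1).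
have x0 : 0 <= m * `|t| by rewrite mulr_ge0// ltW.
set x := m * `|t| in ty x0.
have /andP[nx xn] := truncn_itv x0.
(* The successor gives n > m |t|, so n steps of length at most 1/m suffice, and keeps n positive
   when t = 0. *)
set n := (Num.truncn x).+1 in xn.
have n_le : n%:R <= 2 + y.
  by rewrite /n -natr1 (le_trans (lerD nx (lexx 1)))//; lra.
have m1V : 1 / m <= 1 by rewrite ler_pdivrMr// mul1r.
have tn : `|t| <= n%:R * (1 / m) by rewrite mulrA mulr1 ler_pdivlMr// mulrC ltW.
apply: (le_trans (chained_modulus U0 m1V gU a (ltn0Sn _) tn)).
have tx : `|t| <= y + 1.
  by rewrite (le_trans _ ty)// -[leLHS]mul1r ler_wpM2r.
have t2 : 1 + t ^+ 2 <= 1 + (y + 1) ^+ 2.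
  by rewrite lerD2l -(real_normK (num_real t)) lerXn2r ?nnegrE// addr_ge0.
have a0 : 0 <= 1 + a ^+ 2 by rewrite addr_ge0 ?sqr_ge0.
have -> : n%:R * (4 * U * (1 + a ^+ 2) * (1 + t ^+ 2)) =
  4 * U * (1 + a ^+ 2) * (n%:R * (1 + t ^+ 2)) by ring.
have -> : 60 * U * (1 + a ^+ 2) * (1 + y ^+ 5) =
  4 * U * (1 + a ^+ 2) * (15 * (1 + y ^+ 5)) by ring.
rewrite ler_wpM2l ?mulr_ge0//.
have /le_trans : n%:R * (1 + t ^+ 2) <= (2 + y) * (1 + (y + 1) ^+ 2).
  by rewrite ler_pM// addr_ge0 ?sqr_ge0.
apply.
(* As y, y^2 and y^3 are each at most 1 + y^5, the cubic 4 + 6y + 4y^2 + y^3 is at most 15 + 11 y^5;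
   this gives the 15 in 60 = 4 * 15. *)
have mono (i j : nat) : (i <= j)%N -> y ^+ i <= 1 + y ^+ j.
  move=> ij; have [y1|y1] := lerP y 1.
    by rewrite (le_trans (exprn_ile1 _ y0 y1))// lerDl exprn_ge0.
  by rewrite (le_trans (ler_weXn2l (ltW y1) ij))// lerDr.
have := mono 1 5 isT; have := mono 2 5 isT; have := mono 3 5 isT.
rewrite expr1 => h3 h2 h1.
have -> : (2 + y) * (1 + (y + 1) ^+ 2) = 4 + 6 * y + 4 * y ^+ 2 + y ^+ 3 by ring.
have := exprn_ge0 5 y0; lra.
Qed.

(** * Comparison of suprema and averages with a constant *)

(** Since [0 <= c], multiplication by [c] commutes with the supremum whatever the signs of [k i], so
    the termwise bounds pass to the suprema. The index [i0] makes the ranges nonempty. *)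
Lemma dist_sup_le (R : realType) (I : Type) (i0 : I) (k A : I -> R) (c C K : R) :
  0 <= c -> (forall i, k i <= K) ->
  (forall i, `|k i * A i - k i * c| <= C) ->
  `|sup (range (fun i => k i * A i)) - sup (range k) * c| <= C.
Proof.
move=> c0 kK kA.
have kub : has_ubound (range k) by exists K => _ [i _ <-]; exact: kK.
have k_le i : k i <= sup (range k) by apply: ub_le_sup => //; exists i.
have kA_le i : k i * A i <= sup (range k) * c + C.
  have := kA i; rewrite ler_norml => /andP[_].
  by rewrite lerBlDl => /le_trans -> //; rewrite lerD2r ler_wpM2r.
set N := sup (range (fun i => k i * A i)).
have le_N i : k i * A i <= N.
  apply: ub_le_sup; last by exists i.
  by exists (sup (range k) * c + C) => _ [j _ <-]; exact: kA_le.
rewrite ler_distl lerBlDr; apply/andP; split; last first.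
  by apply: ge_sup; [exists (k i0 * A i0), i0|move=> _ [i _ <-]; exact: kA_le].
have kc i : k i * c <= N + C.
  have := kA i; rewrite distrC ler_norml => /andP[_].
  by rewrite lerBlDl => /le_trans -> //; rewrite lerD2r.
(* The lower bound divides by [c], so [c = 0] is separate; there any index gives [0 <= N + C]. *)
move: c0; rewrite le_eqVlt => /orP[/eqP c0|c0].
  by rewrite -c0 mulr0 (le_trans _ (kc i0))// -c0 mulr0.
rewrite -ler_pdivlMr//; apply: ge_sup; first by exists (k i0), i0.
by move=> _ [i _ <-]; rewrite ler_pdivlMr.
Qed.

(** Integrate c - B <= g <= c + B over [a, b]. *)
Lemma dist_average_le (R : realType) (g : R -> R) (a b c B : R) :
  a < b -> continuous g ->
  (forall v, a <= v <= b -> `|g v - c| <= B) ->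
  `|(b - a)^-1 * \int[lebesgue_measure]_(v in `[a, b]) g v - c| <= B.
Proof.
move=> ab cg gB.
have ig (f : R -> R) : continuous f ->
    lebesgue_measure.-integrable `[a, b] (EFin \o f).
  move=> cf; apply: continuous_compact_integrable; first exact: segment_compact.
  exact: continuous_subspaceT.
have mab : measurable (`[a, b]%classic : set R) by exact: measurable_itv.
have ba : 0 < b - a by rewrite subr_gt0.
have cst (r : R) : \int[lebesgue_measure]_(v in `[a, b]) r = r * (b - a).
  by rewrite Rintegral_cst//= lebesgue_measure_itv/= lte_fin ab.
rewrite ler_distl mulrC; apply/andP; split.
  rewrite ler_pdivlMr// -cst; apply: le_Rintegral => //.
  - by apply: ig => x; exact: cst_continuous.
  - exact: ig.
  - by move=> x /= /[!in_itv]/= /gB; rewrite ler_distl => /andP[].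
rewrite ler_pdivrMr// -cst; apply: le_Rintegral => //.
- exact: ig.
- by apply: ig => x; exact: cst_continuous.
- by move=> x /= /[!in_itv]/= /gB; rewrite ler_distl => /andP[].
Qed.

(** * Logarithmic coordinates, modulus, moments and kernel infimum *)

(** In the variable v = ln z, log-uniform continuity becomes uniform continuity of the weighted
    function, and undoing the weight multiplies by the polynomial 1 + v^2. *)
Lemma logVw_continuous (R : realType) (h : R -> R) :
  logVw h -> continuous (h \o @expR R).
Proof.
move=> [_ lh].
have hE : h \o @expR R =
    (fun v => (1 + v ^+ 2) * (weight (expR v) * h (expR v))).
  apply/funext => v /=; rewrite /weight expRK mulrA mulrCA mulfV ?mulr1 ?mul1r//.
  by rewrite gt_eqF// ltr_pwDl// sqr_ge0.
rewrite hE => v; apply: cvgM.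
  by apply: cvgD; [exact: cvg_cst|exact: exprn_continuous].
apply/(@cvgrPdist_le _ R^o) => e e0.
have [r r0 rP] := lh e e0.
near=> t.
apply/ltW/rP; rewrite ?expR_gt0// !expRK.
by near: t; apply: (@cvgr_dist_le _ R^o _ _ _ id v) => //; exact: cvg_id.
Unshelve. all: by end_near. Qed.

Lemma log_modulus_ge0 (R : realType) (h : R -> R) (rho : R) :
  0 <= rho -> (0 <= log_modulus h rho)%E.
Proof.
move=> rho0; apply: ereal_sup_ubound; exists 1, 1.
by rewrite mulr1 subrr normr0 mul0r ln1 normr0.
Qed.

(** The substitution z = e^a, u = e^d turns the modulus into the additive hypothesis of
    [modulus_growth]. *)
Lemma log_modulus_bound (R : realType) (h : R -> R) (rho U : R) :
  (log_modulus h rho <= U%:E)%E ->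
  forall a d, `|d| <= rho ->
  `|h (expR (a + d)) - h (expR a)| <= U * ((1 + a ^+ 2) * (1 + d ^+ 2)).
Proof.
move=> hU a d dr.
have pos (x : R) : 0 < 1 + x ^+ 2 by rewrite ltr_pwDl// sqr_ge0.
rewrite -ler_pdivrMr ?mulr_gt0// -lee_fin (le_trans _ hU)//.
apply: ereal_sup_ubound; exists (expR d), (expR a); split; rewrite ?expR_gt0 ?expRK//.
by rewrite [a + d]addrC expRD.
Qed.

Lemma abs_moment_ubound (R : realType) (k : R -> R) (mu s : R) (j : int) :
  0 < s ->
  ((`|k (expR (- j%:~R) * s)| * `|j%:~R - ln s| `^ mu)%:E <= abs_moment k mu)%E.
Proof.
move=> s0; apply: le_trans; last first.
  by apply: ereal_sup_ubound; exists s => //; reflexivity.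
by apply: ereal_sup_ubound; exists j.
Qed.

Lemma abs_moment_ge0 (R : realType) (k : R -> R) (mu : R) :
  (0 <= abs_moment k mu)%E.
Proof.
apply: le_trans (abs_moment_ubound k mu 0 (@ltr01 R)).
by rewrite lee_fin mulr_ge0 ?powR_ge0.
Qed.

Lemma abs_moment0_lty (R : realType) (k : R -> R) :
  bounded_Rpos k -> (abs_moment k 0 < +oo)%E.
Proof.
move=> [K kK]; apply: le_lt_trans (ltry K).
apply: ge_ereal_sup => _ [s s0 <-]; apply: ge_ereal_sup => _ [j _ <-].
by rewrite lee_fin powRr0 mulr1 kK// mulr_gt0// expR_gt0.
Qed.

Lemma kernel_inf_le (R : realType) (k : R -> R) (x : R) :
  bounded_Rpos k -> 1 <= x <= expR 1 -> kernel_inf k <= k x.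
Proof.
move=> [K kK] xe; apply: ge_inf; last by exists x => //=; rewrite in_itv.
exists (- K) => _ [y /= /[!in_itv]/= /andP[y1 _] <-].
by have := kK y (lt_le_trans ltr01 y1); rewrite ler_norml => /andP[].
Qed.

Lemma kernel_inf_le_sup (R : realType) (k : R -> R) (s : R) :
  bounded_Rpos k -> 0 < s ->
  kernel_inf k <= sup (range (fun j : int => k (expR (- j%:~R) * s))).
Proof.
move=> kb s0; have [K kK] := kb.
apply: (@le_trans _ _ (k (expR (- (Num.floor (ln s))%:~R) * s))).
  apply: kernel_inf_le => //.
  rewrite -[s in _ * s]lnK ?posrE// -expRD -[leLHS]expR0 !ler_expR.
  have /andP[lo hi] := floor_itv (ln s).
  by move: hi; rewrite intrD1 => hi; lra.
apply: ub_le_sup; last by exists (Num.floor (ln s)).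
exists K => _ [j _ <-].
by rewrite (le_trans (ler_norm _))// kK// mulr_gt0// expR_gt0.
Qed.

(** * Pointwise estimate and passage to the norm *)

(** Real bounds [U], [a], [b] replace the extended-real suprema, so that the estimate takes place in
    [R]. *)
Lemma maxprod_kantorovich_dist (R : realType) (k : R -> R) (m U a b : R)
    (h : R -> R) (z : R) :
  bounded_Rpos k -> 0 < kernel_inf k -> 1 <= m -> logVw_nonneg h ->
  0 <= U -> (log_modulus h (1 / m) <= U%:E)%E ->
  (abs_moment k 0 <= a%:E)%E -> (abs_moment k 5 <= b%:E)%E -> 0 < z ->
  `|maxprod_kantorovich k m h z - h z| <=
    60 * U * (1 + ln z ^+ 2) * (a + b) / kernel_inf k.
Proof.
move=> kb k0 m1 [hV h_ge0] U0 hU ka kb5 z0.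
have m0 : 0 < m by rewrite (lt_le_trans _ m1).
have s0 : 0 < z `^ m by rewrite powR_gt0.
have Dk := kernel_inf_le_sup kb s0.
rewrite /maxprod_kantorovich; set N := sup _; set D := sup _ in Dk *.
have D0 : 0 < D by rewrite (lt_le_trans k0).
have z2 : 0 <= 1 + ln z ^+ 2 by rewrite addr_ge0 ?sqr_ge0.
have ab0 : 0 <= a + b.
  by rewrite addr_ge0// -lee_fin; [apply: le_trans ka|apply: le_trans kb5];
    exact: abs_moment_ge0.
have -> : N / D - h z = (N - D * h z) / D.
  by rewrite mulrBl mulrAC divff ?mul1r// gt_eqF.
rewrite normrM normfV (gtr0_norm D0) ler_pM ?invr_ge0 ?(ltW D0)//; last first.
  by rewrite lef_pV2 ?posrE.
have [K kK] := kb.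
apply: (dist_sup_le (0 : int) (h_ge0 _ z0) (K := K)) => j.
  by rewrite (le_trans (ler_norm _))// kK// mulr_gt0// expR_gt0.
set kj := k _.
have := le_trans (abs_moment_ubound k 0 j s0) ka.
have := le_trans (abs_moment_ubound k 5 j s0) kb5.
rewrite !lee_fin powRr0 mulr1 powR_mulrn// -/kj.
set y := `|_ - _| => hb ha.
rewrite -mulrBr normrM.
have -> : 60 * U * (1 + ln z ^+ 2) * (a + b) =
  (a + b) * (60 * U * (1 + ln z ^+ 2)) by ring.
have g0 : 0 <= 60 * U * (1 + ln z ^+ 2) by rewrite !mulr_ge0.
(* The moment of order 0 absorbs the term 1 and that of order 5 the term y^5: |k_j| (1 + y^5) <= a +
   b. *)
apply: (@le_trans _ _ (`|kj| * (60 * U * (1 + ln z ^+ 2) * (1 + y ^+ 5)))); last first.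
  by rewrite mulrCA [leLHS]mulrC ler_wpM2r// mulrDr mulr1 lerD.
rewrite ler_wpM2l//.
(* As m is the inverse length of the interval, the integral term is a mean. *)
have mE : m = ((j%:~R + 1) / m - j%:~R / m)^-1.
  by rewrite -mulrBl addrC addKr mul1r invrK.
rewrite [X in X * \int[_]_(_ in _) _]mE.
apply: (dist_average_le (g := h \o @expR R)).
- by rewrite ltr_pM2r ?invr_gt0// ltrDl.
- exact: logVw_continuous.
move=> v /andP[v1 v2].
have gU := log_modulus_bound hU.
have := @modulus_growth R (fun t => h (expR t)) U m U0 m1 gU (ln z) (v - ln z) y.
rewrite subrKC lnK//; apply; last exact: normr_ge0.
(* Here j <= m v <= j + 1, hence m |v - ln z| <= y + 1. *)
rewrite ler_pdivrMr// in v1; rewrite ler_pdivlMr// in v2.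
rewrite -[X in X * _]gtr0_norm// -normrM mulrBr /y ln_powR.
have -> : m * v - m * ln z = (m * v - j%:~R) + (j%:~R - m * ln z) by ring.
rewrite (le_trans (ler_normD _ _))// addrC lerD2l.
by rewrite ler_norml; apply/andP; split; lra.
Qed.

Theorem theorem3p3 (R : realType) (k : R -> R) (m : R) (h : R -> R)
  (k_kernel : is_kernel 5 k) (k_inf_gt0 : 0 < kernel_inf k)
  (m_ge1 : 1 <= m) (h_Vw : logVw_nonneg h) :
  (wnorm (fun z => maxprod_kantorovich k m h z - h z)%R
   <= (256 / kernel_inf k)%R%:E * log_modulus h (1 / m)%R
      * (abs_moment k 0%R + 4%R%:E * abs_moment k 5%R))%E.
Proof.
have [_ kb k5] := k_kernel.
have k0 := abs_moment0_lty kb.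
have m0 : 0 <= 1 / m by rewrite divr_ge0// (le_trans _ m_ge1).
have ki : 0 < 256 / kernel_inf k by rewrite divr_gt0.
(* Strict positivity, from k(1) >= [kernel_inf k], matters when the modulus is infinite: a zero
   factor would turn the right-hand side into 0. *)
have kpos : (0 < abs_moment k 0)%E.
  apply: lt_le_trans (abs_moment_ubound k 0 0 (@ltr01 R)).
  rewrite lte_fin powRr0 mulr1 oppr0 expR0 mulr1 normr_gt0 gt_eqF//.
  apply: lt_le_trans k_inf_gt0 (kernel_inf_le kb _).
  by rewrite lexx -[leLHS]expR0 ler_expR ler01.
case aE : (abs_moment k 0) k0 kpos => [a| |]// _ a0.
case bE : (abs_moment k 5) k5 (abs_moment_ge0 k 5) => [b| |]// _ b0.
rewrite lte_fin in a0; rewrite lee_fin in b0.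
case UE : (log_modulus h (1 / m)) (log_modulus_ge0 h m0) => [U| |]// U0.
  rewrite lee_fin in U0.
  apply: ge_ereal_sup => _ [z z0 <-]; rewrite lee_fin.
  have z2 : 0 < 1 + ln z ^+ 2 by rewrite ltr_pwDl// sqr_ge0.
  rewrite /weight mul1r mulrC ler_pdivrMr//.
  have := @maxprod_kantorovich_dist R k m U a b h z kb k_inf_gt0 m_ge1 h_Vw U0.
  rewrite UE aE bE !lexx => /(_ isT isT isT z0)/le_trans; apply.
  rewrite ler_pdivrMr//.
  have -> : 256 / kernel_inf k * U * (a + 4 * b) * (1 + ln z ^+ 2) * kernel_inf k =
      U * (1 + ln z ^+ 2) * (256 * (a + 4 * b)).
    by field; rewrite gt_eqF.
  have -> : 60 * U * (1 + ln z ^+ 2) * (a + b) =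
      U * (1 + ln z ^+ 2) * (60 * (a + b)) by ring.
  (* 60 (a + b) <= 256 (a + 4 b), as a and b are nonnegative. *)
  by rewrite ler_wpM2l ?mulr_ge0 ?(ltW z2)//; lra.
(* For an infinite modulus the right-hand side is +oo. *)
rewrite gt0_muley ?lte_fin// gt0_mulye ?leey// lte_fin.
by rewrite ltr_pwDl// mulr_ge0.
Qed.
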